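(* Assume the quasi-GLM setting of the context with $\beta\in(1,2)$, and assume (C.2), (G.1)–(G.4) with $A=r_n$. Let $\delta\in(0,1/2)$, $\rho\ge0$, $C_{\delta,n,r}(p):=\log(\delta^{-2})+p\log(1+2nr_n)$, $$\alpha=\frac{1}{n^{1/\beta}}\Big[\frac{C_{\delta,n,r}(p)}{(2^{\beta-1}+1)\sigma_R}\Big]^{1/\beta},$$ and let $$\hat\theta_n\in\arg\min_{\theta\in\Theta}\Big\{\frac{1}{n\alpha}\sum_{i=1}^n\psi_\lambda\big[\alpha\big(k(X_i^\top\theta)-Y_iu(X_i^\top\theta)\big)\big]+\rho\|\theta\|_2^2\Big\},\qquad \psi_\lambda(x):=\mathrm{sign}(x)\log(1+|x|+\beta^{-1}|x|^\beta).$$ Then, with probability at least $1-2\delta$, $$R_l(\hat\theta_n)-R_l(\theta^* )\le\frac{2}{n}\,\mathbb{E}\{[|Y|g_{r_n}(X)+h_{r_n}(X)]\|X\|_2\}+C_{\beta,\sigma_R}\Big[\frac{C_{\delta,n,r}(p)}{n}\Big]^{\frac{\beta-1}{\beta}}+\rho\|\theta^*\|_2^2,$$ where $$C_{\beta,\sigma_R}:=\frac{2(2^{\beta-1}+1)\sigma_R+\frac{2^{\beta-1}}{\beta}\mathbb{E}\big|[|Y|g_{r_n}(X)+h_{r_n}(X)]\|X\|_2\big|^\beta}{[(2^{\beta-1}+1)\sigma_R]^{\frac{\beta-1}{\beta}}}.$$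
   Context: Setting: $(X_1,Y_1),\dots,(X_n,Y_n)$ are i.i.d. copies of an $\mathbb{R}^p\times\mathbb{R}$-valued random variable $(X,Y)$. Given a known link function $u(\cdot)$ and a function $b(\cdot)$, put $k(t):=b(u(t))$ and define the quasi-GLM loss $l(y,x,\theta):=k(x^\top\theta)-y\,u(x^\top\theta)$. The risk is $R_l(\theta)=\mathbb{E}[l(Y,X,\theta)]$ and $\theta^*=\arg\min_{\theta\in\Theta}R_l(\theta)$. (C.2) $\Theta\subseteq\mathbb{R}^p$ is convex and there is $r_n\in(0,\infty)$ (possibly depending on $n$) with $\|\theta\|_2\le r_n$ for all $\theta\in\Theta$. (G.1) $u$ is continuously differentiable with $\dot u\ge0$, and there is a positive function $g_A(\cdot)$ with $0\le\dot u(x^\top\theta)\le g_A(x)$ for $\|\theta\|_2\le A$. (G.2) $\ddot b>0$, $k$ is continuously differentiable with $k\ge0$, and there is a positive function $h_A(\cdot)$ with $0<\dot k(x^\top\theta)\le h_A(x)$ for $\|\theta\|_2\le A$. (G.3) $\mathbb{E}\big|[|Y|g_A(X)+h_A(X)]\|X\|_2\big|^\beta<\infty$. (G.4) $\sigma_R:=\sup_{\theta\in\Theta}\mathbb{E}|k(X^\top\theta)-Yu(X^\top\theta)|^\beta/\beta<\infty$ (and it is positive, so that $\alpha$ is defined). Minimizers $\hat\theta_n$ are assumed to exist (any measurable choice). *)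

(* Defs.v *)
From HB Require Import structures.
From mathcomp Require Import all_boot all_order all_algebra.
From mathcomp Require Import all_classical all_reals all_analysis.

Set Implicit Arguments.
Unset Strict Implicit.
Unset Printing Implicit Defensive.

Import Order.TTheory GRing.Theory Num.Theory.
Import numFieldNormedType.Exports.

Local Open Scope classical_set_scope.
Local Open Scope ring_scope.

(* R^p is 'cV[R]_p. The library puts no sigma-algebra on matrices: column
   vectors get the one generated by the coordinates, which for R^p is the Borel
   sigma-algebra. *)
Definition measure_cV_display : measure_display -> measure_display.
Proof. exact. Qed.

Section measurable_cV.
Context {d} {T : sigmaRingType d}.
Variable p : nat.

Let coord : 'I_p -> 'cV[T]_p -> T := fun j x => x j ord0.

Let cV_set0 : g_sigma_preimage coord set0.
Proof. exact: sigma_algebra0. Qed.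

Let cV_setC A : g_sigma_preimage coord A -> g_sigma_preimage coord (~` A).
Proof. exact: sigma_algebraC. Qed.

Let cV_bigcup (F : _^nat) : (forall i, g_sigma_preimage coord (F i)) ->
  g_sigma_preimage coord (\bigcup_i (F i)).
Proof. exact: sigma_algebra_bigcup. Qed.

HB.instance Definition _ := @isMeasurable.Build (measure_cV_display d)
  'cV[T]_p (g_sigma_preimage coord) cV_set0 cV_setC cV_bigcup.

End measurable_cV.

Section linear_algebra.
Context {R : realType} {p : nat}.
Implicit Types x theta : 'cV[R]_p.

Definition dotv x theta : R := (x^T *m theta) ord0 ord0.

(* The library's norm `|x| on matrices is the sup norm. *)
Definition norm2 x : R := Num.sqrt (\sum_(j < p) x j ord0 ^+ 2).

End linear_algebra.

Definition C1 {R : realType} (f : R -> R) : Prop :=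
  (forall t, derivable f t 1) /\ continuous (derive1 f).

Definition is_argmin {V : Type} {disp : Order.disp_t} {W : porderType disp}
    (A : set V) (f : V -> W) (v : V) : Prop :=
  A v /\ forall v', A v' -> (f v <= f v')%O.

Section iid.
Context {d d' : measure_display} {T : measurableType d} {S : measurableType d'}
  {R : realType} (P : probability T R).

Definition identically_distributed (Z Z' : T -> S) : Prop :=
  forall B, measurable B -> P (Z @^-1` B) = P (Z' @^-1` B).

(* Taking some of the B i equal to setT gives the product rule for every
   subfamily. *)
Definition mutually_independent {n : nat} (Z : 'I_n -> T -> S) : Prop :=
  forall B : 'I_n -> set S, (forall i, measurable (B i)) ->
    P [set w | forall i, B i (Z i w)] = (\prod_(i < n) P (Z i @^-1` B i))%E.

Definition iid_copies {n : nat} (Z : 'I_n -> T -> S) (Z0 : T -> S) : Prop :=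
  mutually_independent Z /\ forall i, identically_distributed (Z i) Z0.

Definition with_probability_at_least (E : set T) (q : R) : Prop :=
  measurable E /\ (q%:E <= P E)%E.

End iid.

Definition complexity {R : realType} (delta : R) (n : nat) (r : R) (p : nat) : R :=
  ln (delta ^- 2) + p%:R * ln (1 + 2 * n%:R * r).

Section quasi_glm.
Context {d : measure_display} {T : measurableType d} {R : realType}
  {p : nat} (P : probability T R).
Variables (X : T -> 'cV[R]_p) (Y : T -> R).
Variables (u b : R -> R) (g h : 'cV[R]_p -> R) (beta : R).
Variable Theta : set 'cV[R]_p.

Definition quasi_glm_loss (y : R) (x theta : 'cV[R]_p) : R :=
  (b \o u) (dotv x theta) - y * u (dotv x theta).

Definition risk (theta : 'cV[R]_p) : \bar R :=
  'E_P[fun w => quasi_glm_loss (Y w) (X w) theta].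

Definition envelope (y : R) (x : 'cV[R]_p) : R :=
  (`|y| * g x + h x) * norm2 x.

Definition sigmaR : \bar R :=
  ereal_sup [set 'E_P[fun w => (`|quasi_glm_loss (Y w) (X w) theta| `^ beta
                               / beta)%R]%E | theta in Theta].

Definition psi (x : R) : R :=
  Num.sg x * ln (1 + `|x| + beta^-1 * `|x| `^ beta).

Definition truncation_scale (n : nat) (C sigma : R) : R :=
  (n%:R `^ beta^-1)^-1
  * (C / ((2 `^ (beta - 1) + 1) * sigma)) `^ beta^-1.

Definition penalized_empirical_risk {n : nat} (alpha rho : R)
    (x : 'I_n -> 'cV[R]_p) (y : 'I_n -> R) (theta : 'cV[R]_p) : R :=
  (n%:R * alpha)^-1
    * (\sum_(i < n) psi (alpha * quasi_glm_loss (y i) (x i) theta))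
  + rho * norm2 theta ^+ 2.

Definition rate_constant (sigma : R) : \bar R :=
  (((2 * (2 `^ (beta - 1) + 1) * sigma)%:E
    + (2 `^ (beta - 1) / beta)%:E
      * 'E_P[fun w => (`|envelope (Y w) (X w)| `^ beta)%R])
   * ((((2 `^ (beta - 1) + 1) * sigma) `^ ((beta - 1) / beta))^-1)%:E)%E.

End quasi_glm.

(* Main.v *)
(** Two exponential bounds are combined.  Since exp (psi x) <= 1 + x + |x|^beta / beta
    and psi is odd, the Chernoff method controls the truncated empirical risk of a
    fixed parameter from above and from below.  The upper bound is used at theta^*
    with confidence delta; the lower bound is used simultaneously at all points of a
    (1/n)-net of Theta with total confidence delta, the loss at a net point being
    first decreased by L/n, where L is the envelope, so that by monotonicity of psi it
    bounds the truncated risk of every parameter within 1/n of that point.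

    A maximal 1/n-separated subset of Theta is such a net.  Its cardinality is at most
    (1 + 2 n r)^p by disjointness of the balls of radius 1/(2n) around its points.
    The volume comparison is done by induction on p: at height t of the last
    coordinate, balls are cut along balls of squared radius q - (t - c)^2, and the
    inequality sum_i q_i^(p/2) <= q_0^(p/2) for the slices is integrated over t. *)

Require Import Defs.
From HB Require Import structures.
From mathcomp Require Import all_boot all_order all_algebra.
From mathcomp Require Import all_classical all_reals all_analysis.
From mathcomp Require Import measurable_realfun measurable_fun_approximation simple_functions.
From mathcomp Require Import ring lra.

Set Implicit Arguments.
Unset Strict Implicit.
Unset Printing Implicit Defensive.

Import Order.TTheory GRing.Theory Num.Theory.
Import numFieldNormedType.Exports.

Local Open Scope classical_set_scope.
Local Open Scope ring_scope.

(** * Packing and covering in Euclidean space *)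

Section packing.
Context {R : realType}.
Local Notation mu := (@lebesgue_measure R).

(** Lebesgue measure equals [1/s] times its push-forward under [t -> (t - c) / s]: the two agree on
    half-open intervals, which determine the measure. *)
Lemma ge0_integral_affine (f : R -> \bar R) (c s : R) : 0 < s ->
  measurable_fun [set: R] f -> (forall t, (0 <= f t)%E) ->
  (\int[mu]_t f ((t - c) / s)%R = s%:E * \int[mu]_t f t)%E.
Proof.
move=> s0 mf f0.
pose phi : R -> measurableTypeR R := fun t => (t - c) / s.
have mphi : measurable_fun setT phi.
  by apply: measurable_funM => //; exact: measurable_funB.
have s0' : 0 <= s^-1 by rewrite invr_ge0 ltW.
have muE A : measurable A -> mu A = mscale (NngNum s0') (pushforward mu phi) A.
  move=> mA; apply: lebesgue_measure_unique => //= _ [[a b]] _ <-.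
  rewrite /mscale /= /pushforward /=.
  have -> : phi @^-1` `]a, b] = `]c + s * a, c + s * b]%classic.
    apply/seteqP; split => t /=; rewrite !in_itv /= /phi ltr_pdivlMr// ler_pdivrMr//.
      by move=> /andP[? ?]; apply/andP; split; lra.
    by move=> /andP[? ?]; apply/andP; split; lra.
  rewrite !lebesgue_measure_itv/= !lte_fin ltrD2l ltr_pM2l//.
  case: ifPn => ab; last by rewrite mule0.
  by rewrite -!EFinB -EFinM; congr EFin; field; rewrite gt_eqF.
transitivity (\int[pushforward mu phi]_t f t)%E.
  by rewrite ge0_integral_pushforward.
rewrite [in RHS](_ : \int[mu]_t f t =
    \int[mscale (NngNum s0') (pushforward mu phi)]_t f t)%E; last first.
  by apply: eq_measure_integral => A mA _; exact: muE.
by rewrite ge0_integral_mscale//= muleA -EFinM divff ?gt_eqF// mul1e.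
Qed.

(* The volume of a ball of squared radius [q] up to a factor depending only on [p];
   without the test, an empty ball ([q <= 0]) would get weight [1] when [p = 0]. *)
Definition ball_weight (p : nat) (q : R) : R :=
  if 0 < q then Num.sqrt q ^+ p else 0.

Lemma ball_weight_ge0 p q : 0 <= ball_weight p q.
Proof. by rewrite /ball_weight; case: ifP => // _; rewrite exprn_ge0. Qed.

Lemma measurable_ball_weight p (q : R -> R) : measurable_fun setT q ->
  measurable_fun setT (fun t => ball_weight p (q t)).
Proof.
move=> mq; apply: measurable_fun_ifT => //=.
- by apply: measurable_fun_ltr.
- apply: measurable_funX; apply: measurableT_comp => //.
  exact: continuous_measurable_fun (@sqrt_continuous R).
Qed.

(** By Cavalieri's principle this is the ratio of the volumes of the unit balls in dimensions [p.+1]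
    and [p]. *)
Definition slice_integral (p : nat) : \bar R :=
  (\int[mu]_t (ball_weight p (1 - t ^+ 2))%:E)%E.

(** Allows the constant to be cancelled from an inequality between weights. On [[-1/2, 1/2]] the
    integrand is at least [sqrt(3/4)^p], and it is everywhere at most the indicator of [[-1, 1]]. *)
Lemma slice_integral_bounds p : (0 < slice_integral p < +oo)%E.
Proof.
have mw : measurable_fun setT (fun t : R => (ball_weight p (1 - t ^+ 2))%:E).
  apply/measurable_EFinP; apply: measurable_ball_weight.
  by apply: measurable_funB => //; exact: measurable_funX.
apply/andP; split.
- apply: (@lt_le_trans _ _ (\int[mu]_t ((Num.sqrt (3 / 4) ^+ p) * \1_`[- 2^-1, 2^-1] t)%:E)%E).
    under eq_integral do rewrite EFinM.
    rewrite ge0_integralZl_EFin ?exprn_ge0//; last exact/measurable_EFinP.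
    rewrite integral_indic// setIT [X in (_ * X)%E]lebesgue_measure_itv/= lte_fin.
    have -> : (- 2^-1 < 2^-1 :> R) by lra.
    by rewrite -EFinB -EFinM lte_fin mulr_gt0 ?exprn_gt0 ?sqrtr_gt0//; lra.
  apply: ge0_le_integral => //.
  - by apply/measurable_EFinP; apply: measurable_funM.
  - move=> t _; rewrite lee_fin indicE; case: (boolP (t \in _)) => [|_]; last first.
      by rewrite mulr0 ball_weight_ge0.
    rewrite inE/= in_itv/= mulr1 => /andP[t1 t2].
    have t3 : 3 / 4 <= 1 - t ^+ 2 by nra.
    rewrite /ball_weight ifT; last by lra.
    by rewrite lerXn2r ?nnegrE ?sqrtr_ge0// ler_wsqrtr.
- apply: (@le_lt_trans _ _ (\int[mu]_t (\1_`[(- 1), 1] t)%:E)%E); last first.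
    rewrite integral_indic// setIT [X in (X < _)%E]lebesgue_measure_itv/= lte_fin.
    by case: ifP => _; rewrite ?ltry// -EFinB ltry.
  apply: ge0_le_integral => //.
  - by move=> t _; rewrite lee_fin ball_weight_ge0.
  - exact/measurable_EFinP.
  - move=> t _; rewrite lee_fin /ball_weight; case: ifPn => t0; last first.
      by rewrite indicE.
    rewrite indicE mem_set/=; last by rewrite in_itv/=; apply/andP; split; nra.
    by rewrite exprn_ile1 ?sqrtr_ge0// -[leRHS]sqrtr1 ler_wsqrtr//; nra.
Qed.

(** Substituting [t = c + sqrt q * s] turns [q - (t - c)^2] into [q * (1 - s^2)]: the integrand
    yields [sqrt q ^+ p], and [dt] yields the one further factor. *)
Lemma integral_ball_weight p (c q : R) :
  (\int[mu]_t (ball_weight p (q - (t - c) ^+ 2))%:E =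
   (ball_weight p.+1 q)%:E * slice_integral p)%E.
Proof.
rewrite {2}/ball_weight; case: ifPn => q0; last first.
  rewrite mul0e; apply: integral0_eq => t _; rewrite /ball_weight ifF//.
  by apply/negbTE; move: q0; rewrite -!leNgt => q0; rewrite subr_le0 (le_trans q0)// sqr_ge0.
set s := Num.sqrt q; have s0 : 0 < s by rewrite sqrtr_gt0.
have qE : q = s ^+ 2 by rewrite sqr_sqrtr// ltW.
under eq_integral => t _.
  rewrite (_ : ball_weight _ _ = s ^+ p * ball_weight p (1 - ((t - c) / s) ^+ 2)); last first.
    have -> : q - (t - c) ^+ 2 = s ^+ 2 * (1 - ((t - c) / s) ^+ 2).
      by rewrite qE; field; rewrite gt_eqF.
    rewrite /ball_weight pmulr_rgt0 ?exprn_gt0//; case: ifPn => _; last by rewrite mulr0.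
    by rewrite sqrtrM ?sqr_ge0// sqrtr_sqr ger0_norm ?(ltW s0)// exprMn.
  rewrite EFinM.
over.
have mw : measurable_fun setT (fun t : R => (ball_weight p (1 - t ^+ 2))%:E).
  apply/measurable_EFinP; apply: measurable_ball_weight.
  by apply: measurable_funB => //; exact: measurable_funX.
rewrite ge0_integralZl_EFin ?exprn_ge0 ?(ltW s0)//; last 2 first.
  by move=> t _; rewrite lee_fin ball_weight_ge0.
  apply/measurable_EFinP; apply: measurable_ball_weight.
  apply: measurable_funB => //; apply: measurable_funX.
  by apply: measurable_funM => //; exact: measurable_funB.
rewrite (ge0_integral_affine c s0 mw); last by move=> t; rewrite lee_fin ball_weight_ge0.
by rewrite muleA -EFinM exprSr.
Qed.

(** Points are sequences of which the first [p] entries count, so that the induction on the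
    dimension stays within a single type. *)
Definition sqdist (p : nat) (y x : nat -> R) : R := \sum_(j < p) (y j - x j) ^+ 2.

(** Disjointness and inclusion are stated pointwise for squared radii of any sign, a form that
    slicing preserves: a slice that misses its ball gets a nonpositive squared radius. *)
Lemma ball_packing p m (x : 'I_m -> nat -> R) (q : 'I_m -> R) (x0 : nat -> R) (q0 : R) :
  (forall i j y, i != j -> sqdist p y (x i) < q i -> q j <= sqdist p y (x j)) ->
  (forall i y, sqdist p y (x i) < q i -> sqdist p y x0 < q0) ->
  \sum_(i < m) ball_weight p (q i) <= ball_weight p q0.
Proof.
elim: p q q0 => [|p IHp] q q0 disj incl.
  (* In dimension 0 a ball is empty or the single point, so at most one of the disjoint balls is
     nonempty. *)
  have [[i qi]|noi] := pselect (exists i, 0 < q i).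
    rewrite (bigD1 i)//= big1 ?addr0.
      rewrite /ball_weight qi !expr0 ifT//.
      by have := incl i (fun=> 0); rewrite /sqdist !big_ord0; exact.
    move=> j ji; rewrite /ball_weight ifF//; apply/negbTE; rewrite -leNgt.
    by have := disj i j (fun=> 0); rewrite /sqdist !big_ord0 eq_sym; exact.
  rewrite big1 ?ball_weight_ge0// => i _; rewrite /ball_weight ifF//.
  by apply/negP => qi; apply: noi; exists i.
have /andP[w0 woo] := slice_integral_bounds p.
pose w := fine (slice_integral p).
have wE : slice_integral p = w%:E by rewrite fineK// ge0_fin_numE// ltW.
have w_gt0 : 0 < w by rewrite -lte_fin -wE.
(* Multiplied by the slice constant, each weight in dimension [p.+1] is the integral of the weights
   of its slices. *)
rewrite -(ler_pM2r w_gt0) -lee_fin [leRHS]EFinM -wE -(integral_ball_weight p (x0 p) q0).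
rewrite mulr_suml -sumEFin.
under eq_bigr => i _ do rewrite EFinM -wE -(integral_ball_weight p (x i p) (q i)).
have mE (c q' : R) : measurable_fun setT
    (fun t : R => (ball_weight p (q' - (t - c) ^+ 2))%:E).
  apply/measurable_EFinP; apply: measurable_ball_weight; apply: measurable_funB => //.
  by apply: measurable_funX; exact: measurable_funB.
rewrite -ge0_integral_sum//; last 2 first.
  by move=> i; exact: mE.
  by move=> i t _; rewrite lee_fin ball_weight_ge0.
apply: ge0_le_integral => //.
- by move=> t _; apply: sume_ge0 => i _; rewrite lee_fin ball_weight_ge0.
- by apply: emeasurable_sum => i _; exact: mE.
- exact: mE.
move=> t _; rewrite sumEFin lee_fin.
(* At height [t] the ball around [c] of squared radius [q] is cut in the ball of squared radius
   [q - (t - c p)^2]. *)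
have slice (y c : nat -> R) :
    sqdist p.+1 (fun j => if j == p then t else y j) c = sqdist p y c + (t - c p) ^+ 2.
  rewrite /sqdist big_ord_recr/= eqxx; congr (_ + _); apply: eq_bigr => j _.
  by rewrite ifF// ltn_eqF.
apply: IHp.
- move=> i j y ij; have := disj i j (fun j => if j == p then t else y j) ij.
  by rewrite !slice ltrBrDr lerBlDr; exact.
- move=> i y; have := incl i (fun j => if j == p then t else y j).
  by rewrite !slice !ltrBrDr; exact.
Qed.

End packing.

Section euclidean.
Context {R : realType} {p : nat}.
Implicit Types x y theta : 'cV[R]_p.

Lemma dotvE x theta : dotv x theta = \sum_(j < p) x j ord0 * theta j ord0.
Proof. by rewrite /dotv mxE; apply: eq_bigr => j _; rewrite mxE. Qed.

Lemma dotvB x y theta : dotv x (y - theta) = dotv x y - dotv x theta.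
Proof.
by rewrite !dotvE -sumrB; apply: eq_bigr => j _; rewrite !mxE mulrBr.
Qed.

Lemma norm2_ge0 x : 0 <= norm2 x. Proof. exact: sqrtr_ge0. Qed.

Lemma sqr_norm2 x : norm2 x ^+ 2 = \sum_(j < p) x j ord0 ^+ 2.
Proof. by rewrite sqr_sqrtr// sumr_ge0// => j _; rewrite sqr_ge0. Qed.

Lemma norm2N x : norm2 (- x) = norm2 x.
Proof. by rewrite /norm2; under eq_bigr do rewrite mxE sqrrN. Qed.

Lemma norm2Z (a : R) x : norm2 (a *: x) = `|a| * norm2 x.
Proof.
rewrite /norm2; under eq_bigr do rewrite mxE exprMn.
by rewrite -mulr_sumr sqrtrM ?sqr_ge0// sqrtr_sqr.
Qed.

(** Cauchy-Schwarz, from the sum of squares [B * (A * B - D^2)] of the entries of [B x - D y]; if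
    [B = 0] then [y = 0]. *)
Lemma sqr_dotv_le x y : dotv x y ^+ 2 <= norm2 x ^+ 2 * norm2 y ^+ 2.
Proof.
rewrite !sqr_norm2; set A := \sum_j x j ord0 ^+ 2; set B := \sum_j y j ord0 ^+ 2.
set D := dotv x y.
have B0 : 0 <= B by rewrite sumr_ge0// => j _; rewrite sqr_ge0.
have h : 0 <= B * (A * B - D ^+ 2).
  have -> : B * (A * B - D ^+ 2) = \sum_(j < p) (B * x j ord0 - D * y j ord0) ^+ 2.
    transitivity (\sum_(j < p) (B ^+ 2 * x j ord0 ^+ 2
        - (2 * B * D) * (x j ord0 * y j ord0) + D ^+ 2 * y j ord0 ^+ 2)).
      rewrite big_split/= sumrB -!mulr_sumr -/A -/B -(dotvE x y) -/D; ring.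
    by apply: eq_bigr => j _; ring.
  by rewrite sumr_ge0// => j _; rewrite sqr_ge0.
move: B0; rewrite le_eqVlt => /predU1P[B0|B0]; last first.
  by rewrite -subr_ge0; move: h; rewrite pmulr_rge0.
have y0 j : y j ord0 = 0.
  move/esym/eqP: B0; rewrite psumr_eq0; last by move=> i _; rewrite sqr_ge0.
  by move=> /allP/(_ j); rewrite mem_index_enum sqrf_eq0 => /(_ isT)/eqP.
by rewrite /D dotvE big1 ?expr0n/= -?B0 ?mulr0// => j _; rewrite y0 mulr0.
Qed.

Lemma dotv_le x y : `|dotv x y| <= norm2 x * norm2 y.
Proof.
rewrite -(@ler_pXn2r _ 2%N)// ?nnegrE ?mulr_ge0 ?norm2_ge0//.
by rewrite -normrX ger0_norm ?sqr_ge0// exprMn sqr_dotv_le.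
Qed.

Lemma norm2D x y : norm2 (x + y) <= norm2 x + norm2 y.
Proof.
rewrite -(@ler_pXn2r _ 2%N)// ?nnegrE ?addr_ge0 ?norm2_ge0//.
have -> : norm2 (x + y) ^+ 2 = norm2 x ^+ 2 + 2 * dotv x y + norm2 y ^+ 2.
  rewrite !sqr_norm2 dotvE mulr_sumr -!big_split/=; apply: eq_bigr => j _.
  by rewrite !mxE; ring.
have := le_trans (ler_norm _) (dotv_le x y); nra.
Qed.

End euclidean.

Section covering.
Context {R : realType} {p : nat}.
Variables (Theta : set 'cV[R]_p) (r kappa : R).
Hypotheses (r0 : 0 < r) (kappa0 : 0 < kappa).
Hypothesis Theta_bounded : forall theta, Theta theta -> norm2 theta <= r.

Let separated m (x : 'I_m -> 'cV[R]_p) :=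
  (forall i, Theta (x i)) /\ forall i j, i != j -> kappa < norm2 (x i - x j).

(** Padding by 0 turns a vector into a point as used by [ball_packing]. *)
Let seq_of (x : 'cV[R]_p) (k : nat) : R :=
  if insub k is Some j then x j ord0 else 0.

Let sqdistE (y : nat -> R) (x : 'cV[R]_p) :
  sqdist p y (seq_of x) = norm2 (\col_j y j - x) ^+ 2.
Proof.
by rewrite sqr_norm2; apply: eq_bigr => j _; rewrite /seq_of valK !mxE.
Qed.

Let ball_weight_sqr (s : R) : 0 < s -> ball_weight p (s ^+ 2) = s ^+ p.
Proof. by move=> s0; rewrite /ball_weight exprn_gt0// sqrtr_sqr gtr0_norm. Qed.

(** The balls of radius [kappa / 2] around the points are disjoint and lie in the ball of radius
    [r + kappa / 2] around 0; the bound is the [p]-th power of the ratio of these radii. *)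
Lemma separated_card m (x : 'I_m -> 'cV[R]_p) :
  separated x -> m%:R <= (1 + 2 * r / kappa) ^+ p.
Proof.
move=> [xT xs].
have k2 : 0 < kappa / 2 by rewrite divr_gt0.
have lt2 (v : 'cV[R]_p) s : 0 < s -> (norm2 v ^+ 2 < s ^+ 2) = (norm2 v < s).
  by move=> s0; rewrite ltr_pXn2r// ?nnegrE ?norm2_ge0// ltW.
have := @ball_packing R p m (fun i => seq_of (x i)) (fun=> (kappa / 2) ^+ 2)
  (seq_of 0) ((r + kappa / 2) ^+ 2).
rewrite sumr_const card_ord !ball_weight_sqr ?addr_gt0// => le_pack.
have -> : (1 + 2 * r / kappa) = (r + kappa / 2) / (kappa / 2).
  by field; rewrite gt_eqF.
rewrite expr_div_n ler_pdivlMr ?exprn_gt0// mulr_natl; apply: le_pack.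
- move=> i j y ij; rewrite !sqdistE lt2// => yi; rewrite leNgt lt2//.
  apply/negP => yj; have := xs i j ij; apply/negP; rewrite -leNgt.
  have -> : x i - x j = (\col_k y k - x j) - (\col_k y k - x i).
    by rewrite opprB [RHS]addrC addrA subrK.
  by rewrite (le_trans (norm2D _ _))// norm2N; lra.
- move=> i y; rewrite !sqdistE !lt2 ?addr_gt0// subr0 => yi.
  rewrite -(subrK (x i) (\col_k y k)) (le_lt_trans (norm2D _ _))//.
  by have := Theta_bounded (xT i); lra.
Qed.

(** The size of separated families is bounded, so a largest one exists. A point further than [kappa]
    from all its members could be added to it, so it is a net. *)
Lemma finite_net : exists m (x : 'I_m -> 'cV[R]_p),
  [/\ forall i, Theta (x i),
      forall theta, Theta theta -> exists i, norm2 (theta - x i) <= kappa &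
      m%:R <= (1 + 2 * r / kappa) ^+ p].
Proof.
pose sep m := `[< exists x : 'I_m -> 'cV[R]_p, separated x >].
have ex_sep : exists m, sep m.
  (* The empty family is separated, even when [Theta] is empty. *)
  by exists 0%N; apply/asboolP; exists (fun=> 0); split => -[].
have bound m : sep m -> (m <= Num.truncn ((1 + 2 * r / kappa) ^+ p))%N.
  move=> /asboolP[x sx]; rewrite truncn_ge_nat; last first.
    by rewrite exprn_ge0 ?addr_ge0 ?divr_ge0 ?mulr_ge0 ?(ltW r0) ?(ltW kappa0).
  exact: separated_card sx.
case: (ex_maxnP ex_sep bound) => m /asboolP[x sx] max_m.
exists m, x; split; [by case: sx| |exact: separated_card sx].
move=> theta Ttheta; apply: contrapT => far.
have /max_m : sep m.+1; last by rewrite ltnn.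
(* The uncovered point takes index 0 and the old family is shifted by one. *)
apply/asboolP; exists (fun i => if unlift ord0 i is Some j then x j else theta).
have {}far i : kappa < norm2 (theta - x i).
  by rewrite ltNge; apply/negP => ?; apply: far; exists i.
split=> [i|i j]; first by case: unliftP => [k _|_]//; case: sx.
case: unliftP => [k ->|->]; case: unliftP => [l ->|->] //.
- by rewrite (inj_eq lift_inj); case: sx => _; exact.
- by rewrite -norm2N opprB.
Qed.

End covering.

(** * The truncation function *)

(** Convexity of the power function at the midpoint of [2 * |a|] and [2 * |b|]. *)
Lemma powR_normD_le {R : realType} (a b beta : R) : 1 <= beta ->
  `|a + b| `^ beta <= 2 `^ (beta - 1) * (`|a| `^ beta + `|b| `^ beta).
Proof.
move=> b1; have b0 : 0 <= beta by rewrite (le_trans _ b1).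
apply: (@le_trans _ _ ((`|a| + `|b|) `^ beta)).
  by rewrite ge0_ler_powR ?nnegrE ?addr_ge0 ?ler_normD.
have : (2^-1 * (2 * `|a|) + (1 - 2^-1) * (2 * `|b|)) `^ beta <=
    2^-1 * (2 * `|a|) `^ beta + (1 - 2^-1) * (2 * `|b|) `^ beta.
  by apply: (convex_powR b1 (Itv01 _ _));
    rewrite ?inE/= ?in_itv/= ?mulr_ge0// ?invr_ge0// invf_le1 ?ler1n.
rewrite (_ : 1 - 2^-1 = 2^-1 :> R); last by lra.
rewrite !mulrA mulVf// !mul1r !powRM// => /le_trans; apply.
rewrite -!mulrDr mulrA; apply: ler_wpM2r.
  by rewrite addr_ge0 ?powR_ge0.
by rewrite powRB ?pnatr_eq0 ?implybT// powRr1// mulrC.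
Qed.

Section truncation_function.
Context {R : realType}.
Variable beta : R.
Hypothesis beta12 : 1 < beta < 2.

Let beta1 : 1 < beta. Proof. by case/andP: beta12. Qed.
Let beta_gt0 : 0 < beta. Proof. by rewrite (lt_trans _ beta1). Qed.

Let psi_arg_ge1 (x : R) : 1 <= 1 + `|x| + beta^-1 * `|x| `^ beta.
Proof.
by rewrite -addrA lerDl addr_ge0// mulr_ge0 ?powR_ge0// invr_ge0 ltW.
Qed.

Let psi_arg_pos (x : R) : 1 + `|x| + beta^-1 * `|x| `^ beta \is Num.pos.
Proof. by rewrite posrE (lt_le_trans _ (psi_arg_ge1 x)). Qed.

Lemma psiN (x : R) : psi beta (- x) = - psi beta x.
Proof. by rewrite /psi normrN sgrN mulNr. Qed.

Lemma psi_ge0 (x : R) : 0 <= x -> 0 <= psi beta x.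
Proof. by move=> x0; rewrite /psi mulr_ge0 ?ln_ge0// sgr_ge0. Qed.

Lemma psi_nondecreasing : {homo psi beta : x y / x <= y}.
Proof.
have psi_pos (x y : R) : 0 <= x -> x <= y -> psi beta x <= psi beta y.
  rewrite le_eqVlt => /predU1P[<-|x0] xy; first by rewrite {1}/psi sgr0 mul0r psi_ge0.
  have y0 := lt_le_trans x0 xy.
  rewrite /psi !gtr0_sg// !mul1r ler_ln// !gtr0_norm//.
  apply: lerD; first by rewrite lerD2l.
  by rewrite ler_pM2l ?invr_gt0// ge0_ler_powR ?nnegrE ?(ltW beta_gt0) ?(ltW x0) ?(ltW y0).
move=> x y xy; have [x0|x0] := leP 0 x; first exact: psi_pos.
have [y0|y0] := leP 0 y.
  apply: (@le_trans _ _ 0); last exact: psi_ge0.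
  by rewrite -[x]opprK psiN oppr_le0 psi_ge0// oppr_ge0 ltW.
by rewrite -[x]opprK -[y]opprK (psiN (- x)) (psiN (- y)) lerN2 psi_pos ?lerN2// oppr_ge0 ltW.
Qed.

Lemma measurable_psi : measurable_fun [set: R] (psi beta).
Proof. by apply: nondecreasing_measurable => // x y; exact: psi_nondecreasing. Qed.

(* Young's inequality for a^2 = (a^beta)^th * (a^(2 beta))^(1 - th), th = 2 - 2/beta. *)
Lemma sqr_le_powR_mix (a : R) : 0 <= a ->
  a ^+ 2 <= (2 - 2 / beta) * a `^ beta + (2 / beta - 1) * (a `^ beta) ^+ 2.
Proof.
move=> a0; have /andP[? beta2] := beta12.
set th := 2 - 2 / beta; have th0 : 0 < th.
  by rewrite subr_gt0 ltr_pdivrMr//; lra.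
have th1 : 0 < 1 - th.
  by rewrite (_ : 1 - th = 2 / beta - 1) ?subr_gt0 ?ltr_pdivlMr ?mul1r//; rewrite /th; lra.
have := @conjugate_powR R (a `^ (beta * th)) (a `^ ((2 * beta) * (1 - th)))
  th^-1 (1 - th)^-1 (powR_ge0 _ _) (powR_ge0 _ _).
rewrite !invr_gt0 !invrK -!powRrM -!mulrA !divff ?gt_eqF// !mulr1.
move=> /(_ th0 th1); rewrite addrC subrK => /(_ erefl).
rewrite -powRD; last first.
  by apply/implyP; rewrite gt_eqF// addr_gt0// !mulr_gt0.
have -> : beta * th + 2 * (beta * (1 - th)) = 2 by rewrite /th; field; rewrite gt_eqF.
rewrite powR_mulrn// mulrC (mulrC (_ `^ _)) => /le_trans; apply.
rewrite [2 * beta]mulrC powRrM powR_mulrn ?powR_ge0//.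
by rewrite (_ : 1 - th = 2 / beta - 1)//; rewrite /th; lra.
Qed.

(** Equality for [x >= 0] by the choice of [psi]. For [x < 0] the left side is the reciprocal of
    [1 + |x| + |x|^beta / beta], and the product of that with the right side has to be at least
    1. *)
Lemma expR_psi_le (x : R) :
  expR (psi beta x) <= 1 + x + beta^-1 * `|x| `^ beta.
Proof.
have [x0|x0|->] := ltgtP x 0; last 2 first.
- by rewrite /psi gtr0_sg// mul1r lnK// gtr0_norm.
- by rewrite /psi sgr0 mul0r expR0 normr0 powR0 ?gt_eqF// mulr0 !addr0.
(* with s = |x|^beta / beta, the claim amounts to (1 + s)^2 - x^2 >= 1 *)
rewrite /psi ltr0_sg// mulN1r expRN lnK// -[leLHS]mul1r ler_pdivrMr; last first.
  exact: psi_arg_pos.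
have := sqr_le_powR_mix (normr_ge0 x); rewrite ltr0_norm//.
set t := (- x) `^ beta; have t0 : 0 <= t by exact: powR_ge0.
have /andP[? beta2] := beta12.
set i := beta^-1; have i2 : 2^-1 < i by rewrite ltf_pV2 ?posrE.
(* These are the margins over [sqr_le_powR_mix]: the coefficients of [t^2] differ by
   [i^2 - (2i - 1) = (1 - i)^2], those of [t] by [2i - (2 - 2i) = 4 (i - 1/2)]. *)
have : 0 <= (1 - i) ^+ 2 * t ^+ 2 by rewrite mulr_ge0 ?sqr_ge0.
have : 0 <= (i - 2^-1) * t by rewrite mulr_ge0// subr_ge0 ltW.
nra.
Qed.

End truncation_function.

(** * Concentration of truncated sums *)

Section independence.
Context {d d' : measure_display} {T : measurableType d} {S : measurableType d'}
  {R : realType} (P : probability T R).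
Local Open Scope ereal_scope.

Import HBNNSimple.

(** Both sides are additive in [f] and continuous along increasing sequences, so agreement on
    indicators passes to simple functions and then to their monotone limits. *)
Lemma ge0_eq_integral_comp (V : T -> S) (K1 K2 : T -> R) :
  measurable_fun setT V ->
  measurable_fun setT K1 -> (forall w, 0 <= K1 w)%R ->
  measurable_fun setT K2 -> (forall w, 0 <= K2 w)%R ->
  (forall B, measurable B ->
    \int[P]_w (\1_B (V w) * K1 w)%:E = \int[P]_w (\1_B (V w) * K2 w)%:E) ->
  forall f : S -> R, measurable_fun setT f -> (forall s, 0 <= f s)%R ->
  \int[P]_w (f (V w) * K1 w)%:E = \int[P]_w (f (V w) * K2 w)%:E.
Proof.
move=> mV mK1 K10 mK2 K20 K12 f mf f0.
have mEf : measurable_fun setT (EFin \o f) by exact/measurable_EFinP.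
pose h := nnsfun_approx measurableT mEf.
have mI (B : set S) : measurable B -> measurable_fun setT (fun w => \1_B (V w) : R).
  by move=> mB; apply: (@measurableT_comp _ _ _ _ _ _ (\1_B : S -> R) _ V).
have lim_h (K : T -> R) : measurable_fun setT K -> (forall w, 0 <= K w)%R ->
    \int[P]_w (f (V w) * K w)%:E = limn (fun n => \int[P]_w (h n (V w) * K w)%:E).
  move=> mK K0; rewrite -monotone_convergence//.
  - apply: eq_integral => w _; apply/esym/cvg_lim => //.
    under eq_fun do rewrite EFinM.
    rewrite EFinM; apply: cvgeZr => //.
    by apply: (@cvg_nnsfun_approx _ _ _ _ measurableT _ mEf) => // s _; rewrite lee_fin.
  - move=> n; apply/measurable_EFinP; apply: measurable_funM => //.
    exact: measurableT_comp.
  - by move=> n w _; rewrite lee_fin mulr_ge0.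
  - move=> w _ a b ab; rewrite lee_fin ler_wpM2r//.
    exact/lefP/nd_nnsfun_approx.
have sum_h (K : T -> R) n : measurable_fun setT K -> (forall w, 0 <= K w)%R ->
    \int[P]_w (h n (V w) * K w)%:E =
    \sum_(y \in range (h n)) \int[P]_w ((y * (\1_(h n @^-1` [set y]) (V w) * K w))%:E).
  move=> mK K0; rewrite -ge0_integral_fsum//.
  - apply: eq_integral => w _; rewrite EFinM fimfunE -fsumEFin// ge0_mule_fsuml.
      by apply: eq_fsbigr => y _; rewrite -EFinM mulrA.
    by move=> y; exact: nnfun_muleindic_ge0.
  - move=> y; apply/measurable_EFinP; apply: measurable_funM => //.
    apply: measurable_funM => //; apply: mI; exact: measurable_funPTI.
  - move=> y w _; rewrite mulrA EFinM mule_ge0//; last by rewrite lee_fin.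
    exact: nnfun_muleindic_ge0.
rewrite !lim_h//; congr (limn _); apply/funext => n; rewrite !sum_h//.
(* The scalar [y] leaves the integral when it is nonnegative; a negative [y] has empty preimage. *)
apply: eq_fsbigr => y _; have [y0|y0] := leP 0%R y; last first.
  rewrite (preimage_nnfun0 (h n) y0).
  by apply: eq_integral => w _; rewrite indic0 !mul0r.
under eq_integral do rewrite EFinM.
under [RHS]eq_integral do rewrite EFinM.
rewrite !ge0_integralZl_EFin//; first by rewrite K12.
- by move=> w _; rewrite lee_fin mulr_ge0.
- apply/measurable_EFinP; apply: measurable_funM => //.
  by apply: mI; exact: measurable_funPTI.
- by move=> w _; rewrite lee_fin mulr_ge0.
- apply/measurable_EFinP; apply: measurable_funM => //.
  by apply: mI; exact: measurable_funPTI.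
Qed.

Lemma integral_prod_independent n (Z : 'I_n -> T -> S) (f : 'I_n -> S -> R) :
  (forall i, measurable_fun setT (Z i)) -> mutually_independent P Z ->
  (forall i, measurable_fun setT (f i)) -> (forall i s, 0 <= f i s)%R ->
  (forall i, \int[P]_w (f i (Z i w))%:E < +oo) ->
  \int[P]_w (\prod_(i < n) f i (Z i w))%:E = \prod_(i < n) \int[P]_w (f i (Z i w))%:E.
Proof.
move=> mZ indep.
have mfZ (h : S -> R) i : measurable_fun setT h ->
    measurable_fun setT (fun w => h (Z i w)).
  by move=> mh; apply: (@measurableT_comp _ _ _ _ _ _ h _ (Z i)).
(* the indicators of the product rule are replaced by general functions one
   coordinate at a time: [g i] is an indicator for [k <= i] *)
suff H k : (k <= n)%N -> forall g : 'I_n -> S -> R,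
    (forall i, measurable_fun setT (g i)) -> (forall i s, 0 <= g i s)%R ->
    (forall i, \int[P]_w (g i (Z i w))%:E < +oo) ->
    (forall i : 'I_n, (k <= i)%N -> exists2 B, measurable B & g i = \1_B) ->
    \int[P]_w (\prod_(i < n) g i (Z i w))%:E =
    \prod_(i < n) \int[P]_w (g i (Z i w))%:E.
  move=> mf f0 foo; apply: (H n) => // i.
  by rewrite leqNgt ltn_ord.
elim: k => [_ | k IHk kn] g mg g0 goo gI.
  (* With indicators only, the claim is the product rule for the events [B i]. *)
  have {}gI i : exists B, measurable B /\ g i = \1_B.
    by have [B mB gB] := gI i (leq0n i); exists B.
  have [B HB] := choice gI.
  transitivity (P [set w | forall i, B i (Z i w)]).
    transitivity (\int[P]_w (\1_[set w | forall i, B i (Z i w)] w)%:E).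
      apply: eq_integral => w _; congr EFin; rewrite indicE.
      have [wB|wB] := boolP (w \in _).
        rewrite big1// => i _; rewrite (HB i).2 indicE mem_set//.
        by move: wB; rewrite inE; exact.
      have [i Bi] : exists i, ~ B i (Z i w).
        by apply/existsNP => ?; move/negP: wB; apply; rewrite inE.
      by rewrite (bigD1 i)//= (HB i).2 indicE memNset// mul0r.
    rewrite integral_indic ?setIT//.
    rewrite (_ : [set w | _] = \big[setI/setT]_(i < n) (Z i @^-1` B i)).
      by apply: bigsetI_measurable => i _; rewrite -[X in measurable X]setTI;
        apply: mZ => //; exact: (HB i).1.
    apply/seteqP; split => w /=; rewrite -bigcap_seq/=.
      by move=> Bw i _; exact: Bw.
    by move=> Bw i; apply: Bw; rewrite /= mem_index_enum.
  rewrite indep; last by move=> i; exact: (HB i).1.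
  apply: eq_bigr => i _; rewrite (HB i).2.
  rewrite (_ : (fun w => (\1_(B i) (Z i w))%:E) = (fun w => (\1_(Z i @^-1` B i) w)%:E))//.
  rewrite integral_indic ?setIT//; rewrite -[X in measurable X]setTI.
  by apply: mZ => //; exact: (HB i).1.
pose i0 := Ordinal kn.
(* [G] collects the factors other than [i0], and [c] is the product of their integrals. By
   [ge0_eq_integral_comp] it suffices to exchange [G] for [c] against indicators of [Z i0]. *)
pose G w := (\prod_(i < n | i != i0) g i (Z i w))%R.
have G0 w : (0 <= G w)%R by exact: prodr_ge0.
have mG : measurable_fun setT G.
  rewrite /G; under eq_fun do rewrite -big_filter.
  by apply: measurable_prod => i _; exact: mfZ.
have int_fin i : \int[P]_w (g i (Z i w))%:E \is a fin_num.
  by rewrite ge0_fin_numE// integral_ge0// => w _; rewrite lee_fin.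
pose c := (\prod_(i < n | i != i0) fine (\int[P]_w (g i (Z i w))%:E))%R.
have cE : \prod_(i < n | i != i0) \int[P]_w (g i (Z i w))%:E = c%:E.
  by rewrite -prodEFin; apply: eq_bigr => i _; rewrite fineK.
have c0 : (0 <= c)%R.
  by apply: prodr_ge0 => i _; rewrite fine_ge0// integral_ge0// => w _; rewrite lee_fin.
have GcE (h : S -> R) (mh : measurable_fun setT h) (h0 : forall s, (0 <= h s)%R) :
    \int[P]_w (h (Z i0 w) * c)%:E = \int[P]_w (h (Z i0 w))%:E * c%:E.
  under eq_integral do rewrite EFinM muleC.
  rewrite ge0_integralZl_EFin//; first by rewrite muleC.
    by move=> w _; rewrite lee_fin.
  by apply/measurable_EFinP; exact: mfZ.
rewrite [RHS](bigD1 i0)//= cE -GcE//.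
transitivity (\int[P]_w (g i0 (Z i0 w) * G w)%:E).
  by apply: eq_integral => w _; rewrite (bigD1 i0).
apply: ge0_eq_integral_comp => // B mB.
rewrite GcE//.
(* An indicator at [i0], whose index is [k], makes all factors from [k] on indicators, as the
   induction hypothesis requires. *)
pose g' i := if i == i0 then \1_B else g i.
have g'N i : i != i0 -> g' i = g i by rewrite /g' => /negbTE ->.
have g'0 : g' i0 = \1_B by rewrite /g' eqxx.
transitivity (\int[P]_w (\prod_(i < n) g' i (Z i w))%:E).
  apply: eq_integral => w _; rewrite [in RHS](bigD1 i0)//= g'0; congr ((_ * _)%:E).
  by apply: eq_bigr => i ii0; rewrite g'N.
rewrite IHk ?(ltnW kn)//.
- rewrite (bigD1 i0)//= g'0 -cE; congr (_ * _).
  by apply: eq_bigr => i ii0; rewrite g'N.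
- by move=> i; rewrite /g'; case: ifP.
- by move=> i s; rewrite /g'; case: ifP => // _; rewrite indicE.
- move=> i; rewrite /g'; case: ifP => // _.
  apply: (@le_lt_trans _ _ (\int[P]_w (cst 1) w)).
    apply: ge0_le_integral => //.
    - by apply/measurable_EFinP; apply: mfZ.
    - by move=> w _; rewrite lee_fin indicE; case: (_ \in _).
  by rewrite integral_cst// mul1e (le_lt_trans (probability_le1 P measurableT)) ?ltry.
- move=> i ki; rewrite /g'; case: ifP => [_|ii0]; first by exists B.
  apply: gI; rewrite ltn_neqAle ki andbT; apply/negP => /eqP ki'.
  by move/negP: ii0; apply; apply/eqP/val_inj.
Qed.

End independence.

Section truncated_mean.
Context {d d' : measure_display} {T : measurableType d} {S : measurableType d'}
  {R : realType} (P : probability T R).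
Variables (n : nat) (Z : 'I_n -> T -> S) (Z0 : T -> S).
Hypotheses (mZ : forall i, measurable_fun setT (Z i)) (mZ0 : measurable_fun setT Z0).
Hypothesis Z_iid : iid_copies P Z Z0.
Local Open Scope ereal_scope.

Lemma ge0_integral_identically_distributed (f : S -> R) i :
  measurable_fun setT f -> (forall s, 0 <= f s)%R ->
  \int[P]_w (f (Z i w))%:E = \int[P]_w (f (Z0 w))%:E.
Proof.
move=> mf f0.
have mEf : measurable_fun setT (EFin \o f) by exact/measurable_EFinP.
have Ef0 : {in [set: S], forall s, 0 <= (EFin \o f) s}.
  by move=> s _; rewrite lee_fin.
have := ge0_integral_pushforward (mZ i) P measurableT mEf Ef0.
have := ge0_integral_pushforward mZ0 P measurableT mEf Ef0.
rewrite !preimage_setT /= => <- <-.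
apply: eq_measure_integral => A mA _.
by case: Z_iid => _ /(_ i A mA).
Qed.

(** Markov's inequality for the exponential of the sum: the expectation factors by independence, and
    each factor is at most [1 + alpha * m + alpha^beta * V] by [expR_psi_le]. The [1/beta] of [psi]
    is absorbed in [V]. *)
Lemma chernoff_sum_truncated (beta alpha m V t : R) (xi : S -> R) :
  (1 < beta < 2)%R -> (0 < alpha)%R -> measurable_fun setT xi ->
  P.-integrable setT (EFin \o (xi \o Z0)) -> \int[P]_w (xi (Z0 w))%:E = m%:E ->
  \int[P]_w (`|xi (Z0 w)| `^ beta / beta)%:E <= V%:E ->
  P [set w | n%:R * (alpha * m + alpha `^ beta * V) + t <=
             \sum_(i < n) psi beta (alpha * xi (Z i w))]%R <= (expR (- t))%:E.
Proof.
move=> beta12 alpha0 mxi int_xi Exi mom.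
have beta0 : (0 < beta)%R by case/andP: beta12 => b1 _; rewrite (lt_trans _ b1).
pose f s := expR (psi beta (alpha * xi s)).
have mf : measurable_fun setT f.
  apply: measurableT_comp => //; apply: measurableT_comp.
    exact: measurable_psi.
  exact: measurable_funM.
have f0 s : (0 <= f s)%R by exact: expR_ge0.
pose M := (1 + alpha * m + alpha `^ beta * V)%R.
have mxiZ0 : measurable_fun setT (xi \o Z0) by exact: measurableT_comp.
have mmom : measurable_fun setT (fun w => `|xi (Z0 w)| `^ beta / beta)%R.
  apply: measurable_funM => //.
  apply: (@measurableT_comp _ _ _ _ _ _ (@powR R ^~ beta)) => //.
  exact: measurableT_comp.
have mom0 w : (0 <= `|xi (Z0 w)| `^ beta / beta)%R.
  by rewrite divr_ge0 ?powR_ge0// ltW.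
have int_mom : P.-integrable setT (fun w => (`|xi (Z0 w)| `^ beta / beta)%:E).
  apply/integrableP; split; first exact/measurable_EFinP.
  under eq_integral do rewrite gee0_abs ?lee_fin//.
  by rewrite (le_lt_trans mom)// ltry.
have fM : \int[P]_w (f (Z0 w))%:E <= M%:E.
  pose bound w := (1 + alpha%:E * (xi (Z0 w))%:E)
    + (alpha `^ beta)%:E * (`|xi (Z0 w)| `^ beta / beta)%:E.
  have int1 : P.-integrable setT (fun w => alpha%:E * (xi (Z0 w))%:E).
    exact: integrableZl.
  have int2 : P.-integrable setT
      (fun w => (alpha `^ beta)%:E * (`|xi (Z0 w)| `^ beta / beta)%:E).
    exact: integrableZl.
  have intc : P.-integrable setT (cst 1 : T -> \bar R).
    exact: finite_measure_integrable_cst.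
  have int3 : P.-integrable setT (fun w => 1 + alpha%:E * (xi (Z0 w))%:E).
    exact: integrableD.
  apply: (@le_trans _ _ (\int[P]_w bound w)).
    apply: ge0_le_integral => //.
    - by move=> w _; rewrite lee_fin.
    - by apply/measurable_EFinP; exact: (@measurableT_comp _ _ _ _ _ _ f _ Z0).
    - by apply: (measurable_int P); exact: integrableD.
    - move=> w _; rewrite /bound /= -!EFinM -!EFinD lee_fin.
      rewrite (le_trans (expR_psi_le beta12 _))// normrM (gtr0_norm alpha0).
      by rewrite powRM// ?(ltW alpha0)// mulrCA mulrA mulrAC -!mulrA.
  have -> : \int[P]_w bound w = 1 + alpha%:E * \int[P]_w (xi (Z0 w))%:E
      + (alpha `^ beta)%:E * \int[P]_w (`|xi (Z0 w)| `^ beta / beta)%:E.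
    rewrite integralD// integralD// !integralZl//; congr (_ + _ + _).
    by rewrite integral_cst// mul1e; exact: probability_setT.
  rewrite Exi /M.
  rewrite [in leRHS]EFinD [in leRHS]EFinD !EFinM leeD2l//.
  by rewrite lee_pmul2l// lte_fin powR_gt0.
have M0 : (0 <= M)%R.
  rewrite -lee_fin (le_trans _ fM)// integral_ge0// => w _; rewrite lee_fin//.
have EprodE : \int[P]_w (\prod_(i < n) f (Z i w))%:E <= (M ^+ n)%:E.
  rewrite (@integral_prod_independent _ _ _ _ _ P _ Z (fun=> f) mZ (proj1 Z_iid))//; last first.
    move=> i; rewrite ge0_integral_identically_distributed//.
    by rewrite (le_lt_trans fM)// ltry.
  under eq_bigr do rewrite ge0_integral_identically_distributed//.
  have fE : \int[P]_w (f (Z0 w))%:E = (fine (\int[P]_w (f (Z0 w))%:E))%:E.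
    rewrite fineK// ge0_fin_numE ?(le_lt_trans fM) ?ltry//.
    by rewrite integral_ge0// => w _; rewrite lee_fin.
  rewrite fE prodEFin lee_fin prodr_const card_ord lerXn2r ?nnegrE//.
    by rewrite fine_ge0// integral_ge0// => w _; rewrite lee_fin.
  by rewrite -lee_fin -fE.
pose A := (n%:R * (alpha * m + alpha `^ beta * V) + t)%R.
pose Sn w := (\sum_(i < n) psi beta (alpha * xi (Z i w)))%R.
have mSn : measurable_fun setT Sn.
  apply: measurable_sum => i; apply: measurableT_comp.
    exact: measurable_psi.
  by apply: measurable_funM => //; exact: measurableT_comp.
have mE : measurable [set w | (A <= Sn w)%R].
  by rewrite -[X in measurable X]setTI; exact: measurable_fun_le.
(* Markov's inequality. *)
have eA : (expR A)%:E * P [set w | (A <= Sn w)%R] <= (M ^+ n)%:E.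
  apply: le_trans EprodE.
  rewrite -[X in P X]setIT -integral_indic// -ge0_integralZl_EFin ?expR_ge0//; last first.
    exact/measurable_EFinP.
  apply: ge0_le_integral => //.
  - by apply/measurable_EFinP; exact: measurable_funM.
  - apply/measurable_EFinP; apply: measurable_prod => i _.
    exact: (@measurableT_comp _ _ _ _ _ _ f _ (Z i)).
  - move=> w _; rewrite -EFinM lee_fin -expR_sum indicE.
    have [wA|_] := boolP (w \in _); last by rewrite mulr0 expR_ge0.
    by rewrite mulr1 ler_expR; move: wA; rewrite inE.
(* From [1 + y <= exp y], raised to the power [n]. *)
have Mn : (M ^+ n <= expR (n%:R * (alpha * m + alpha `^ beta * V)))%R.
  rewrite mulrC expRM_natr lerXn2r ?nnegrE ?expR_ge0// /M -addrA.
  exact: expR_ge1Dx.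
rewrite -(@lee_pmul2l _ (expR A)%:E)//; last by rewrite lte_fin expR_gt0.
rewrite (le_trans eA)// -EFinM lee_fin (le_trans Mn)// -expRD ler_expR /A.
by rewrite addrK.
Qed.

End truncated_mean.

(** * The quasi-GLM loss *)

Section measurable_vectors.
Context {R : realType} {p : nat}.

Lemma measurable_coord (j : 'I_p) :
  measurable_fun setT (fun x : 'cV[R]_p => x j ord0).
Proof.
move=> _ B mB; rewrite setTI; apply: sub_sigma_algebra => /=.
by rewrite (bigD1 j)//=; left; exists B => //; rewrite setTI.
Qed.

Lemma measurable_dotv (theta : 'cV[R]_p) :
  measurable_fun setT (fun x : 'cV[R]_p => dotv x theta).
Proof.
under eq_fun do rewrite dotvE.
apply: measurable_sum => j; apply: measurable_funM => //.
exact: measurable_coord.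
Qed.

Lemma measurable_norm2B (c : 'cV[R]_p) :
  measurable_fun setT (fun x : 'cV[R]_p => norm2 (x - c)).
Proof.
have msqrt : measurable_fun [set: R] (@Num.sqrt R).
  exact: continuous_measurable_fun (@sqrt_continuous R).
apply: (measurableT_comp msqrt).
apply: measurable_sum => j; apply: measurable_funX.
under eq_fun do rewrite !mxE.
by apply: measurable_funB => //; exact: measurable_coord.
Qed.

End measurable_vectors.

(** Mean value theorem: the intermediate point is the product of [x] with a convex combination of
    [theta] and [theta'], which stays in the ball of radius [r] where the derivative is bounded. *)
Lemma dotv_image_lipschitz {R : realType} {p : nat} (f : R -> R) (r G : R)
    (x theta theta' : 'cV[R]_p) :
  C1 f -> (forall th, norm2 th <= r -> `|derive1 f (dotv x th)| <= G) ->
  norm2 theta <= r -> norm2 theta' <= r ->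
  `|f (dotv x theta) - f (dotv x theta')| <= G * (norm2 x * norm2 (theta - theta')).
Proof.
move=> [df _] fG.
wlog le_dot : theta theta' / dotv x theta' <= dotv x theta.
  move=> H th th'; have [/H->//|/ltW/H] := leP (dotv x theta') (dotv x theta).
  by rewrite distrC -(norm2N (theta - _)) opprB; exact.
move=> th th'; set a := dotv x theta'; set b := dotv x theta.
have df' (t : R) : is_derive t (1 : R) f (derive1 f t).
  by rewrite derive1E; exact/derivableP.
have [c] : exists2 c, c \in `[a, b] & f b - f a = derive1 f c * (b - a).
  apply: MVT_segment => //.
  apply: continuous_subspaceT => t.
  exact/differentiable_continuous/derivable1_diffP.
rewrite in_itv/= => /andP[ac cb] ->.
have ab_le : `|b - a| <= norm2 x * norm2 (theta - theta').
  by rewrite -dotvB dotv_le.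
(* [s] is the barycentric coordinate of [c] in [[a, b]], set to 0 when the interval is a point. *)
have [s /andP[s0 s1] cE] : exists2 s, 0 <= s <= 1 & c = (1 - s) * a + s * b.
  have [ab|ab] := eqVneq a b.
    by exists 0; [rewrite lexx ler01|rewrite subr0 mul1r mul0r addr0; lra].
  have ab0 : 0 < b - a by rewrite subr_gt0 lt_neqAle ab.
  exists ((c - a) / (b - a)); last by field; rewrite gt_eqF.
  by rewrite divr_ge0 ?(ltW ab0) ?subr_ge0//= ler_pdivrMr// mul1r lerD2r.
have -> : c = dotv x ((1 - s) *: theta' + s *: theta).
  rewrite cE /a /b !dotvE !mulr_sumr -big_split/=.
  by apply: eq_bigr => j _; rewrite !mxE; ring.
rewrite normrM; apply: ler_pM => //; apply: fG.
rewrite (le_trans (norm2D _ _))// !norm2Z !ger0_norm ?subr_ge0//.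
nra.
Qed.

Section quasi_glm_loss_theory.
Context {R : realType} {p : nat}.
Variables (u b : R -> R) (g h : 'cV[R]_p -> R) (r : R).
Hypotheses (hu : C1 u) (hk : C1 (b \o u)).
Hypothesis hg : forall x theta : 'cV[R]_p, norm2 theta <= r ->
  0 <= derive1 u (dotv x theta) <= g x.
Hypothesis hh : forall x theta : 'cV[R]_p, norm2 theta <= r ->
  0 < derive1 (b \o u) (dotv x theta) <= h x.

Lemma quasi_glm_loss_lipschitz (y : R) (x theta theta' : 'cV[R]_p) :
  norm2 theta <= r -> norm2 theta' <= r ->
  `|quasi_glm_loss u b y x theta - quasi_glm_loss u b y x theta'|
  <= envelope g h y x * norm2 (theta - theta').
Proof.
move=> th th'.
have hG th0 : norm2 th0 <= r -> `|derive1 u (dotv x th0)| <= g x.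
  by move=> /(hg x)/andP[? ?]; rewrite ger0_norm.
have hH th0 : norm2 th0 <= r -> `|derive1 (b \o u) (dotv x th0)| <= h x.
  by move=> /(hh x)/andP[? ?]; rewrite gtr0_norm.
have U := dotv_image_lipschitz hu hG th th'.
have K := dotv_image_lipschitz hk hH th th'.
rewrite /quasi_glm_loss /envelope.
set ku := (b \o u) _ in K *; set ku' := (b \o u) _ in K *.
have -> : ku - y * u (dotv x theta) - (ku' - y * u (dotv x theta')) =
    (ku - ku') - y * (u (dotv x theta) - u (dotv x theta')) by ring.
rewrite (le_trans (ler_normB _ _))// normrM.
have := ler_wpM2l (normr_ge0 y) U; lra.
Qed.

Lemma measurable_quasi_glm_loss (theta : 'cV[R]_p) :
  measurable_fun setT (fun z : 'cV[R]_p * R => quasi_glm_loss u b z.2 z.1 theta).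
Proof.
have C1m (f : R -> R) : C1 f ->
    measurable_fun setT (fun z : 'cV[R]_p * R => f (dotv z.1 theta)).
  move=> [df _]; apply: measurableT_comp.
    apply: continuous_measurable_fun => t.
    exact/differentiable_continuous/derivable1_diffP.
  exact: (measurableT_comp (measurable_dotv theta)).
apply: measurable_funB; first exact: C1m.
by apply: measurable_funM => //; exact: C1m.
Qed.

Lemma measurable_envelope : measurable_fun setT g -> measurable_fun setT h ->
  measurable_fun setT (fun z : 'cV[R]_p * R => envelope g h z.2 z.1).
Proof.
move=> mg mh; apply: measurable_funM; last first.
  apply: (@measurableT_comp _ _ _ _ _ _ (@norm2 R p) _ fst) => //.
  by have := @measurable_norm2B R p 0; under eq_fun do rewrite subr0.
apply: measurable_funD; last exact: (measurableT_comp mh).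
apply: measurable_funM; last exact: (measurableT_comp mg).
exact: measurableT_comp.
Qed.

End quasi_glm_loss_theory.

(** From [|f| <= 1 + |f|^beta] and finiteness of [P]. *)
Lemma integrable_of_moment {d} {T : measurableType d} {R : realType}
    (P : probability T R) (f : T -> R) (beta : R) : 1 <= beta ->
  measurable_fun setT f -> (\int[P]_w (`|f w| `^ beta)%:E < +oo)%E ->
  P.-integrable setT (EFin \o f).
Proof.
move=> b1 mf foo; apply/integrableP; split; first exact/measurable_EFinP.
have mfb : measurable_fun setT (fun w => (`|f w| `^ beta)%:E).
  apply/measurable_EFinP; apply: (@measurableT_comp _ _ _ _ _ _ (@powR R ^~ beta)) => //.
  exact: measurableT_comp.
apply: (@le_lt_trans _ _ (\int[P]_w (1 + (`|f w| `^ beta)%:E))%E).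
  apply: ge0_le_integral => //.
  - by do 2 apply: measurableT_comp => //.
  - by apply: emeasurable_funD.
  - move=> w _; rewrite -EFinD lee_fin; have [f1|f1] := leP 1 `|f w|.
      by rewrite (le_trans (le1r_powR f1 b1))// lerDr.
    by rewrite (le_trans (ltW f1))// lerDl powR_ge0.
rewrite ge0_integralD//.
apply: lte_add_pinfty => //; rewrite (@integral_cst _ _ _ P _ measurableT 1) mul1e.
by rewrite (le_lt_trans (probability_le1 P measurableT)) ?ltry.
Qed.

(* [Theta] need not be measurable: the sublevel set is approximated through finite nets. *)
Lemma measurable_lipschitz_sublevel {d} {T : measurableType d} {R : realType}
    {p : nat} (Theta : set 'cV[R]_p) (r M c : R) (F : 'cV[R]_p -> R)
    (V : T -> 'cV[R]_p) : 0 < r -> 0 <= M ->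
  (forall theta, Theta theta -> norm2 theta <= r) ->
  (forall th th', Theta th -> Theta th' -> F th <= F th' + M * norm2 (th - th')) ->
  measurable_fun setT V -> (forall w, Theta (V w)) ->
  measurable [set w | F (V w) <= c].
Proof.
move=> r0 M0 bnd lipF mV VT.
have approx (k : nat) : exists A : set T, [/\ measurable A,
    [set w | F (V w) <= c] `<=` A &
    A `<=` [set w | F (V w) <= c + 2 * M / k.+1%:R]].
  have k0 : 0 < k.+1%:R^-1 :> R by rewrite invr_gt0.
  have [m [x [xT cov _]]] := finite_net r0 k0 bnd.
  (* Passing from [V w] to a net point costs [M / k.+1], and so does the way back, hence the slack
     [2 * M / k.+1], which vanishes in the intersection over [k]. *)
  pose D := [set i : 'I_m | F (x i) <= c + M / k.+1%:R].
  exists (\bigcup_(i in D) [set w | norm2 (V w - x i) <= k.+1%:R^-1]); split.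
  - apply: fin_bigcup_measurable => [|i _]; first exact: finite_finset.
    rewrite -[X in measurable X]setTI.
    apply: measurable_fun_le => //.
    exact: (measurableT_comp (measurable_norm2B (x i)) mV).
  - move=> w /= wc; have [i wi] := cov _ (VT w); exists i => //=.
    rewrite /D/= (le_trans (lipF _ _ (xT i) (VT w)))// lerD// ler_wpM2l//.
    by rewrite -norm2N opprB.
  - move=> w [i]/= Di wi; rewrite (le_trans (lipF _ _ (VT w) (xT i)))//.
    have : M * norm2 (V w - x i) <= M / k.+1%:R by rewrite ler_wpM2l.
    move: Di; rewrite /D/= -mulrA; set q := M / _; lra.
have [A HA] := choice approx.
rewrite (_ : [set w | _] = \bigcap_k A k).
  by apply: bigcapT_measurable => k; case: (HA k).
apply/seteqP; split=> w /= wc; first by move=> k _; case: (HA k) => _ /(_ w wc).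
apply/ler_addgt0Pr => e e0.
have [k ke] : exists k : nat, 2 * M / k.+1%:R <= e.
  exists (Num.truncn (2 * M / e)); rewrite ler_pdivrMr// [e * _]mulrC -ler_pdivrMr//.
  exact/ltW/truncnS_gt.
have [_ _ /(_ w (wc k I))/=] := HA k; move=> /le_trans; apply.
by rewrite lerD2l.
Qed.

(** * Arithmetic of the truncation scale and of the excess risk *)

Lemma truncation_scaleE {R : realType} (beta C sigma : R) (n : nat) :
  (0 < n)%N -> 0 <= C -> 0 < sigma ->
  truncation_scale beta n C sigma =
  (C / n%:R / ((2 `^ (beta - 1) + 1) * sigma)) `^ beta^-1.
Proof.
move=> n0 C0 s0; rewrite /truncation_scale.
set S := (_ + 1) * sigma.
have S0 : 0 < S by rewrite mulr_gt0// addr_gt0 ?powR_gt0.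
have -> : C / n%:R / S = n%:R^-1 * (C / S) by ring.
rewrite [RHS]powRM ?invr_ge0 ?divr_ge0 ?(ltW S0)//.
by rewrite -[n%:R^-1]powR_inv1// -powRrM mulN1r powRN.
Qed.

Lemma complexity_gt0 {R : realType} (delta : R) (n p : nat) (r : R) :
  0 < delta < 2^-1 -> 0 < r -> 0 < complexity delta n r p.
Proof.
move=> /andP[d0 d2] r0; rewrite /complexity.
rewrite ltr_pwDl ?mulr_ge0 ?ln_ge0 ?lerDl ?mulr_ge0 ?(ltW r0)//.
rewrite ln_gt0// -exprVn; apply: exprn_egt1 => //.
by rewrite -(invr1 R) ltf_pV2 ?posrE//; lra.
Qed.

(** [Sh], [Ss] are the truncated sums and [rh], [rs] the risks at the estimator and at the risk
    minimizer, [rj] is the risk at a net point, and [A] stands for [a^beta]. The term [EL / N]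
    enters twice: through the decrease of the loss at the net point and through the risk gap between
    estimator and net point. *)
Lemma excess_risk_arith {R : realFieldType} (N a A V s t0 t1 EL rj rs rh Sh Ss pen pen' : R) :
  0 < N -> 0 < a -> 0 <= pen' ->
  (N * a)^-1 * Sh + pen' <= (N * a)^-1 * Ss + pen ->
  - Sh < N * (a * (EL / N - rj) + A * V) + t1 ->
  Ss < N * (a * rs + A * s) + t0 ->
  rh <= rj + EL / N ->
  rh - rs <= 2 / N * EL + A / a * (V + s) + (t0 + t1) / (N * a) + pen.
Proof.
move=> N0 a0 pen'0 argmin HSh HSs Hrh.
have Na0 : 0 < N * a by rewrite mulr_gt0.
have Sh_le : Sh <= Ss + N * a * pen.
  have : (N * a)^-1 * Sh <= (N * a)^-1 * Ss + pen by lra.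
  by rewrite -(ler_pM2l Na0) mulrDr !mulrA divff ?gt_eqF// !mul1r.
rewrite -(ler_pM2l Na0).
have -> : N * a * (2 / N * EL + A / a * (V + s) + (t0 + t1) / (N * a) + pen) =
    2 * (a * EL) + N * A * (V + s) + (t0 + t1) + N * a * pen.
  by field; rewrite !gt_eqF.
have : N * a * rh <= N * a * rj + a * EL.
  have -> : N * a * rj + a * EL = N * a * (rj + EL / N) by field; rewrite gt_eqF.
  by rewrite ler_pM2l.
have E1 : N * (a * (EL / N - rj) + A * V) = a * EL - N * a * rj + N * A * V.
  by field; rewrite gt_eqF.
rewrite E1 in HSh.
nra.
Qed.

(** * Moments of the envelope and of the loss, Lipschitz continuity of the risk *)

Section uniform_deviation.
Context {R : realType} {d : measure_display} {T : measurableType d}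
  (P : probability T R) {p : nat}.
Variables (X : {RV P >-> 'cV[R]_p}) (Y : {RV P >-> R}).
Variables (u b : R -> R) (g h : 'cV[R]_p -> R) (beta r : R) (Theta : set 'cV[R]_p).
Hypotheses (hbeta : 1 < beta < 2) (hu : C1 u) (hk : C1 (b \o u)).
Hypotheses (mg : measurable_fun setT g) (mh : measurable_fun setT h).
Hypotheses (hg_gt0 : forall x, 0 < g x) (hh_gt0 : forall x, 0 < h x).
Hypothesis hg : forall x theta : 'cV[R]_p, norm2 theta <= r ->
  0 <= derive1 u (dotv x theta) <= g x.
Hypothesis hh : forall x theta : 'cV[R]_p, norm2 theta <= r ->
  0 < derive1 (b \o u) (dotv x theta) <= h x.
Hypothesis hbounded : forall theta, Theta theta -> norm2 theta <= r.
Hypothesis hG3 : ('E_P[fun w => (`|envelope g h (Y w) (X w)| `^ beta)%R] < +oo)%E.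
Hypothesis hG4 : (0 < sigmaR P X Y u b beta Theta < +oo)%E.

Local Notation loss theta := (fun w => quasi_glm_loss u b (Y w) (X w) theta).
Local Notation env := (fun w => envelope g h (Y w) (X w)).
Local Notation sigma := (fine (sigmaR P X Y u b beta Theta)).
Local Notation real_risk theta := (fine (risk P X Y u b theta)).

Let beta1 : 1 < beta. Proof. by case/andP: hbeta. Qed.
Let beta0 : 0 < beta. Proof. by rewrite (lt_trans _ beta1). Qed.

Lemma measurable_XY : measurable_fun setT (fun w => (X w, Y w)).
Proof. exact: measurable_fun_pair. Qed.

Lemma measurable_loss_XY theta : measurable_fun setT (loss theta).
Proof. exact: (measurableT_comp (measurable_quasi_glm_loss hu hk theta) measurable_XY). Qed.

Lemma measurable_envelope_XY : measurable_fun setT env.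
Proof. exact: (measurableT_comp (measurable_envelope mg mh) measurable_XY). Qed.

Lemma envelope_ge0 y x : 0 <= envelope g h y x.
Proof.
by rewrite mulr_ge0 ?norm2_ge0// addr_ge0 ?mulr_ge0 ?normr_ge0 ?(ltW (hg_gt0 _)) ?(ltW (hh_gt0 _)).
Qed.

Lemma integrable_envelope : P.-integrable setT (EFin \o env).
Proof.
apply: (@integrable_of_moment _ _ _ _ _ beta); first exact: ltW.
  exact: measurable_envelope_XY.
by move: hG3; rewrite unlock.
Qed.

Lemma expectation_envelopeE : ('E_P[env] = (fine 'E_P[env])%:E)%E.
Proof. by rewrite fineK// unlock integrable_fin_num//; exact: integrable_envelope. Qed.

Lemma expectation_envelope_ge0 : 0 <= fine 'E_P[env]%E.
Proof. by rewrite fine_ge0// expectation_ge0// => w; exact: envelope_ge0. Qed.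

Lemma expectation_envelope_powRE : ('E_P[fun w => (`|env w| `^ beta)%R] =
  (fine 'E_P[fun w => (`|env w| `^ beta)%R])%:E)%E.
Proof.
by rewrite fineK// ge0_fin_numE// expectation_ge0// => w; exact: powR_ge0.
Qed.

Lemma sigmaRE : sigmaR P X Y u b beta Theta = sigma%:E.
Proof.
by case/andP: hG4 => s0 soo; rewrite fineK// ge0_fin_numE// ltW.
Qed.

Lemma sigma_gt0 : 0 < sigma.
Proof. by rewrite fine_gt0//. Qed.

Lemma integral_loss_powR_le theta : Theta theta ->
  (\int[P]_w (`|loss theta w| `^ beta / beta)%:E <= sigma%:E)%E.
Proof.
move=> Ttheta; rewrite -sigmaRE; apply: ereal_sup_ubound; exists theta => //.
by rewrite unlock.
Qed.

Lemma measurable_powR_normr (f : T -> R) : measurable_fun setT f ->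
  measurable_fun setT (fun w => `|f w| `^ beta).
Proof.
move=> mf; apply: (@measurableT_comp _ _ _ _ _ _ (@powR R ^~ beta)) => //.
exact: measurableT_comp.
Qed.

Lemma integral_powR_normr_div (f : T -> R) : measurable_fun setT f ->
  (\int[P]_w (`|f w| `^ beta / beta)%:E =
   (beta^-1)%:E * \int[P]_w (`|f w| `^ beta)%:E)%E.
Proof.
move=> mf; rewrite -ge0_integralZl_EFin ?invr_ge0 ?(ltW beta0)//.
- by apply: eq_integral => w _; rewrite -EFinM mulrC.
- by apply/measurable_EFinP; exact: measurable_powR_normr.
Qed.

Lemma integrable_loss theta : Theta theta -> P.-integrable setT (EFin \o loss theta).
Proof.
move=> Ttheta; apply: (@integrable_of_moment _ _ _ _ _ beta); first exact: ltW.
  exact: measurable_loss_XY.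
have := integral_loss_powR_le Ttheta.
rewrite (integral_powR_normr_div (measurable_loss_XY theta)) => le_s.
rewrite -(@lte_pmul2l _ (beta^-1)%:E)//; last by rewrite lte_fin invr_gt0.
by rewrite (le_lt_trans le_s)// gt0_muley ?ltry// lte_fin invr_gt0.
Qed.

Lemma riskE theta : Theta theta -> risk P X Y u b theta = (real_risk theta)%:E.
Proof.
move=> Ttheta; rewrite fineK// /risk unlock.
by apply: integrable_fin_num => //; exact: integrable_loss.
Qed.

Lemma risk_lipschitz theta theta' : Theta theta -> Theta theta' ->
  real_risk theta <= real_risk theta' + fine 'E_P[env]%E * norm2 (theta - theta').
Proof.
move=> th th'; rewrite -lee_fin EFinD EFinM -expectation_envelopeE -!riskE//.
rewrite /risk unlock muleC -integralZl//; last exact: integrable_envelope.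
rewrite -integralD//; last 2 first.
  exact: integrable_loss.
  by apply: integrableZl => //; exact: integrable_envelope.
apply: le_integral => //.
- exact: integrable_loss.
- apply: integrableD => //; first exact: integrable_loss.
  by apply: integrableZl => //; exact: integrable_envelope.
- move=> w _; rewrite /= -EFinM -EFinD lee_fin.
  have := quasi_glm_loss_lipschitz hu hk hg hh (Y w) (X w)
    (hbounded th) (hbounded th').
  by move=> /(le_trans (ler_norm _)); rewrite mulrC; lra.
Qed.

(** Supplies the moment bound at the net points, with [c = 1/n]: [powR_normD_le] separates the two
    terms, and [c <= 1] bounds the scaled envelope by the envelope. *)
Lemma integral_shifted_loss_powR_le (theta : 'cV[R]_p) (c : R) :
  Theta theta -> 0 <= c <= 1 ->
  (\int[P]_w (`|c * env w - loss theta w| `^ beta / beta)%:E <=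
   (2 `^ (beta - 1) *
     (sigma + fine 'E_P[fun w => (`|env w| `^ beta)%R]%E / beta))%:E)%E.
Proof.
move=> Ttheta /andP[c0 c1].
have mE := measurable_envelope_XY; have mL := measurable_loss_XY theta.
rewrite EFinM [X in (_ * X)%E]EFinD.
have -> : (fine 'E_P[fun w => (`|env w| `^ beta)%R]%E / beta)%:E =
    (\int[P]_w (`|env w| `^ beta / beta)%:E)%E.
  rewrite integral_powR_normr_div// mulrC EFinM -expectation_envelope_powRE.
  by rewrite unlock.
have m1 (f : T -> R) : measurable_fun setT f ->
    measurable_fun setT (fun w => (`|f w| `^ beta / beta)%:E).
  by move=> mf; apply/measurable_EFinP; apply: measurable_funM => //;
    exact: measurable_powR_normr.
have ge0 (f : T -> R) w : (0 <= (`|f w| `^ beta / beta)%:E)%E.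
  by rewrite lee_fin divr_ge0 ?powR_ge0// ltW.
apply: (@le_trans _ _ (\int[P]_w ((2 `^ (beta - 1))%:E *
    ((`|loss theta w| `^ beta / beta)%:E + (`|env w| `^ beta / beta)%:E)))%E); last first.
  rewrite ge0_integralZl_EFin ?powR_ge0//; last 2 first.
    by move=> w _; rewrite adde_ge0// ?(ge0 (loss theta)) ?(ge0 env).
    by apply: emeasurable_funD; [exact: (m1 _ mL)|exact: (m1 _ mE)].
  rewrite ge0_integralD//; [|by move=> w _; exact: (ge0 (loss theta))|exact: (m1 _ mL)|
    by move=> w _; exact: (ge0 env)|exact: (m1 _ mE)].
  rewrite lee_wpmul2l ?lee_fin ?powR_ge0// leeD2r// integral_loss_powR_le//.
apply: ge0_le_integral => //.
- by move=> w _; rewrite lee_fin divr_ge0 ?powR_ge0// ltW.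
- apply: (m1 (fun w => c * env w - loss theta w)).
  by apply: measurable_funB => //; exact: measurable_funM.
- by apply: measurable_funeM; apply: emeasurable_funD; [exact: (m1 _ mL)|exact: (m1 _ mE)].
move=> w _; rewrite -EFinD -EFinM lee_fin -mulrDl mulrA.
rewrite ler_wpM2r ?invr_ge0 ?(ltW beta0)//.
rewrite -normrN opprB (le_trans (powR_normD_le _ _ (ltW beta1)))//.
rewrite ler_wpM2l ?powR_ge0// lerD2l normrN ge0_ler_powR ?nnegrE ?(ltW beta0)//.
by rewrite normrM (ger0_norm c0) ler_piMl.
Qed.

End uniform_deviation.

(** * Union bound over the net and the excess risk inequality *)

Theorem corollary11
  (R : realType) (d : measure_display) (T : measurableType d)
  (P : probability T R) (n p : nat) (hn : (0 < n)%N)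
  (* the generic pair (X, Y) and its i.i.d. copies *)
  (X : {RV P >-> 'cV[R]_p}) (Y : {RV P >-> R})
  (Xs : 'I_n -> {RV P >-> 'cV[R]_p}) (Ys : 'I_n -> {RV P >-> R})
  (hiid : iid_copies P (fun i w => (Xs i w, Ys i w)) (fun w => (X w, Y w)))
  (u b : R -> R) (beta : R) (hbeta : 1 < beta < 2)
  (* (C.2) *)
  (Theta : set 'cV[R]_p) (hconvex : convex_set (Theta : set (convex_lmodType 'cV[R]_p)))
  (r : R) (hr : 0 < r) (hbounded : forall theta, Theta theta -> norm2 theta <= r)
  (* (G.1) *)
  (hu : C1 u) (hu_ge0 : forall t, 0 <= derive1 u t)
  (g : 'cV[R]_p -> R) (mg : measurable_fun setT g) (hg_gt0 : forall x, 0 < g x)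
  (hg : forall x theta : 'cV[R]_p, norm2 theta <= r ->
     0 <= derive1 u (dotv x theta) <= g x)
  (* (G.2) *)
  (hb : forall t, derivable b t 1) (hb' : forall t, derivable (derive1 b) t 1)
  (hb_gt0 : forall t, 0 < derive1 (derive1 b) t)
  (hk : C1 (b \o u)) (hk_ge0 : forall t, 0 <= (b \o u) t)
  (h : 'cV[R]_p -> R) (mh : measurable_fun setT h) (hh_gt0 : forall x, 0 < h x)
  (hh : forall x theta : 'cV[R]_p, norm2 theta <= r ->
     0 < derive1 (b \o u) (dotv x theta) <= h x)
  (* (G.3) *)
  (hG3 : ('E_P[fun w => (`|envelope g h (Y w) (X w)| `^ beta)%R] < +oo)%E)
  (* (G.4) *)
  (hG4 : (0 < sigmaR P X Y u b beta Theta < +oo)%E)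
  (thetas : 'cV[R]_p) (hthetas : is_argmin Theta (risk P X Y u b) thetas)
  (delta : R) (hdelta : 0 < delta < 2^-1) (rho : R) (hrho : 0 <= rho) :
  let sigma : R := fine (sigmaR P X Y u b beta Theta) in
  let C : R := complexity delta n r p in
  let alpha : R := truncation_scale beta n C sigma in
  forall (theta_hat : {RV P >-> 'cV[R]_p})
    (htheta_hat : forall w, is_argmin Theta
       (penalized_empirical_risk u b beta alpha rho
          (fun i => Xs i w) (fun i => Ys i w)) (theta_hat w)),
  with_probability_at_least P
    [set w |
      (risk P X Y u b (theta_hat w) - risk P X Y u b thetas
       <= (2 / n%:R)%:E * 'E_P[fun w' => envelope g h (Y w') (X w')]
          + rate_constant P X Y g h beta sigma
            * ((C / n%:R) `^ ((beta - 1) / beta))%:E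
          + (rho * norm2 thetas ^+ 2)%:E)%E]
    (1 - 2 * delta).
Proof.
move=> sigma C alpha theta_hat htheta_hat.
have /andP[d0 d2] := hdelta.
have /andP[b1 _] := hbeta.
have b0 : 0 < beta by rewrite (lt_trans _ b1).
have s0 : 0 < sigma := sigma_gt0 hG4.
have C0 : 0 < C by exact: complexity_gt0.
have N0 : 0 < n%:R :> R by rewrite ltr0n.
pose Sg := (2 `^ (beta - 1) + 1) * sigma.
have Sg0 : 0 < Sg by rewrite mulr_gt0// addr_gt0 ?powR_gt0.
(* [q] is [alpha^beta]. This choice makes the deviation term [C / (n * alpha)] equal to
   [alpha^(beta - 1) * Sg], of the same order as the truncation bias. *)
pose q := C / n%:R / Sg.
have q0 : 0 < q by rewrite !divr_gt0.
have alphaE : alpha = q `^ beta^-1 by rewrite /alpha truncation_scaleE// ltW.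
have a0 : 0 < alpha by rewrite alphaE powR_gt0.
have abE : alpha `^ beta = q.
  by rewrite alphaE -powRrM mulVf ?gt_eqF// powRr1// ltW.
have abaE : alpha `^ beta / alpha = q `^ ((beta - 1) / beta).
  rewrite abE alphaE; have -> : (beta - 1) / beta = 1 - beta^-1.
    by rewrite mulrBl divff ?gt_eqF// mul1r.
  rewrite powRB ?powRr1 ?(ltW q0)//.
  by apply/implyP => _; rewrite gt_eqF.
pose env w := envelope g h (Y w) (X w).
pose EL := fine 'E_P[env]%E.
pose EB := fine 'E_P[fun w => (`|env w| `^ beta)%R]%E.
have ELE : ('E_P[env] = EL%:E)%E by exact: (expectation_envelopeE hbeta mg mh hG3).
have EBE : ('E_P[fun w => (`|env w| `^ beta)%R] = EB%:E)%E.
  exact: expectation_envelope_powRE.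
have EL0 : 0 <= EL by exact: expectation_envelope_ge0.
pose rr theta := fine (risk P X Y u b theta).
have rE theta : Theta theta -> risk P X Y u b theta = (rr theta)%:E.
  by move=> ?; exact: (riskE hbeta hu hk hG4).
have Tstar : Theta thetas by case: hthetas.
have That w : Theta (theta_hat w) by case: (htheta_hat w).
have lipr th th' : Theta th -> Theta th' ->
    rr th <= rr th' + EL * norm2 (th - th').
  by move=> ? ?; exact: (risk_lipschitz hbeta hu hk mg mh hg hh hbounded hG3 hG4).
pose pen := rho * norm2 thetas ^+ 2.
pose V := 2 `^ (beta - 1) * (sigma + EB / beta).
pose bound := 2 / n%:R * EL + alpha `^ beta / alpha * (V + sigma) + C / (n%:R * alpha) + pen.
pose event := [set w | rr (theta_hat w) <= rr thetas + bound].
have eventE : [set w |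
      (risk P X Y u b (theta_hat w) - risk P X Y u b thetas
       <= (2 / n%:R)%:E * 'E_P[fun w' => envelope g h (Y w') (X w')]
          + rate_constant P X Y g h beta sigma
            * ((C / n%:R) `^ ((beta - 1) / beta))%:E
          + (rho * norm2 thetas ^+ 2)%:E)%E] = event.
  (* Since [V + sigma = Sg + 2^(beta - 1) / beta * EB], adding the [Sg] of the deviation term
     produces the numerator of the rate constant. *)
  have rateE : ((2 * (2 `^ (beta - 1) + 1) * sigma) + (2 `^ (beta - 1) / beta) * EB)
      * (Sg `^ ((beta - 1) / beta))^-1 * (C / n%:R) `^ ((beta - 1) / beta) =
      alpha `^ beta / alpha * (V + sigma) + C / (n%:R * alpha).
    have -> : C / (n%:R * alpha) = alpha `^ beta / alpha * Sg.
      by rewrite abE /q; field; rewrite !gt_eqF.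
    rewrite -mulrDr abaE {1}/q [in RHS]powRM ?divr_ge0 ?invr_ge0 ?(ltW C0) ?(ltW N0) ?(ltW Sg0)//.
    rewrite -[Sg^-1]powR_inv1 ?(ltW Sg0)// -powRrM mulN1r powRN /V /Sg.
    field. by rewrite !gt_eqF// powR_gt0.
  by apply/seteqP; split=> w /=; rewrite /rate_constant !rE// -/env ELE EBE
    -!EFinM -!EFinD lee_fin -/Sg rateE lerBlDl /event/= /bound /pen !addrA.
rewrite eventE.
have mevent : measurable event.
  by apply: (@measurable_lipschitz_sublevel _ _ _ _ _ _ _ (rr thetas + bound) rr
    theta_hat hr EL0 hbounded lipr).
split=> //.
have Ninv0 : 0 < n%:R^-1 :> R by rewrite invr_gt0.
have [m [x [xT cov mle]]] := finite_net hr Ninv0 hbounded.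
pose cN : R := (1 + 2 * n%:R * r) ^+ p.
have cNbase : 0 < 1 + 2 * n%:R * r by rewrite addr_gt0 ?mulr_gt0.
have cN0 : 0 < cN by rewrite exprn_gt0.
have {}mle : m%:R <= cN.
  by move: mle; rewrite invrK /cN (_ : 2 * r * n%:R = 2 * n%:R * r)//; ring.
pose Z i w := (Xs i w, Ys i w).
pose Z0 w := (X w, Y w).
have mZ i : measurable_fun setT (Z i) by exact: measurable_XY.
have mZ0 : measurable_fun setT Z0 by exact: measurable_XY.
pose lz theta (z : 'cV[R]_p * R) := quasi_glm_loss u b z.2 z.1 theta.
have mlz theta : measurable_fun setT (lz theta) by exact: measurable_quasi_glm_loss.
pose ez (z : 'cV[R]_p * R) := envelope g h z.2 z.1.
have mez : measurable_fun setT ez by exact: measurable_envelope.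
(* The negative of the decreased loss at [x j]; since [psi] is odd, the lower tail of that loss
   becomes an upper tail for [xi j]. *)
pose xi j z := n%:R^-1 * ez z - lz (x j) z.
have mxi j : measurable_fun setT (xi j).
  by apply: measurable_funB => //; exact: measurable_funM.
(* Chosen so that [exp (- t0) = delta] and [exp (- t1) = delta / cN]: the minimizer and the whole
   net cost [delta] each, and [t0 + t1] is exactly [C]. *)
pose t0 := - ln delta.
pose t1 := - ln delta + p%:R * ln (1 + 2 * n%:R * r).
have CE : C = t0 + t1.
  rewrite /C /complexity lnV ?posrE ?exprn_gt0// lnXn// /t0 /t1 mulr2n; lra.
pose B0 := [set w | n%:R * (alpha * rr thetas + alpha `^ beta * sigma) + t0 <=
             \sum_(i < n) psi beta (alpha * lz thetas (Z i w))].
pose B1 j := [set w | n%:R * (alpha * (EL / n%:R - rr (x j)) + alpha `^ beta * V) + t1 <=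
             \sum_(i < n) psi beta (alpha * xi j (Z i w))].
have mB (f : 'cV[R]_p * R -> R) c : measurable_fun setT f ->
    measurable [set w | c <= \sum_(i < n) psi beta (alpha * f (Z i w))].
  move=> mf; rewrite -[X in measurable X]setTI; apply: measurable_fun_le => //.
  apply: measurable_sum => i; apply: (measurableT_comp (measurable_psi hbeta)).
  by apply: measurable_funM => //; exact: (measurableT_comp mf (mZ i)).
have mB0 : measurable B0 by exact: mB.
have mB1 j : measurable (B1 j) by exact: mB.
have PB0 : (P B0 <= delta%:E)%E.
  have -> : delta = expR (- t0) by rewrite opprK lnK.
  apply: (chernoff_sum_truncated mZ mZ0 hiid) => //.
  - exact: (integrable_loss hbeta hu hk hG4).
  - by rewrite -(rE _ Tstar) /risk unlock.
  - exact: (integral_loss_powR_le hG4).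
have PB1 j : (P (B1 j) <= (delta / cN)%:E)%E.
  have -> : delta / cN = expR (- t1).
    rewrite /t1 opprD opprK expRD lnK ?posrE// expRN; congr (_ / _).
    by rewrite mulrC expRM_natr lnK.
  have intE : P.-integrable setT (EFin \o env).
    exact: (integrable_envelope hbeta mg mh hG3).
  have intL : P.-integrable setT (fun w => (lz (x j) (Z0 w))%:E).
    exact: (integrable_loss hbeta hu hk hG4).
  have intE' : P.-integrable setT (fun w => (n%:R^-1)%:E * (env w)%:E)%E.
    exact: integrableZl.
  apply: (chernoff_sum_truncated mZ mZ0 hiid) => //.
  - rewrite (_ : EFin \o _ =
        (fun w => (n%:R^-1)%:E * (env w)%:E - (lz (x j) (Z0 w))%:E)%E); last first.
      by apply/funext => w.
    exact: integrableB.
  - transitivity (\int[P]_w ((n%:R^-1)%:E * (env w)%:E - (lz (x j) (Z0 w))%:E))%E.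
      by apply: eq_integral.
    rewrite integralB// integralZl// EFinB mulrC EFinM.
    by congr (_ * _ - _)%E; [rewrite -ELE unlock|rewrite -(rE _ (xT j)) /risk unlock].
  - apply: (integral_shifted_loss_powR_le hbeta hu hk mg mh hG3 hG4) => //.
    by rewrite invr_ge0 ler0n invf_le1// ler1n.
pose bad := B0 `|` \big[setU/set0]_(j < m) B1 j.
have mU : measurable (\big[setU/set0]_(j < m) B1 j) by exact: bigsetU_measurable.
have mbad : measurable bad by exact: measurableU.
have Pbad : (P bad <= (2 * delta)%:E)%E.
  rewrite mulrDl mul1r EFinD (le_trans (measureU2 _ mB0 mU))//.
  apply: leeD => //.
  apply: (@le_trans _ _ (\sum_(j < m) (delta / cN)%:E)%E).
    have [//] : measurable (\big[setU/set0]_(j < m) B1 j) /\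
        (P (\big[setU/set0]_(j < m) B1 j) <= \sum_(j < m) (delta / cN)%:E)%E.
    (* Measurability of the partial unions is carried along for [measureU2]. *)
    apply: (big_rec2 (fun A s => measurable A /\ (P A <= s)%E)) => [|j A s _ [mA PA]].
      by rewrite measure0.
    split; first exact: measurableU.
    apply: (le_trans (measureU2 _ (mB1 j) mA)); exact: leeD (PB1 j) PA.
  rewrite sumEFin lee_fin sumr_const card_ord -mulr_natl mulrCA.
  by rewrite ler_piMr ?(ltW d0)// ler_pdivrMr// mul1r.
have good : ~` bad `<=` event.
  move=> w /not_orP[/negP nB0 nB1].
  have [j xj] := cov _ (That w).
  have /negP {}nB1 : ~ B1 j w.
    move=> Bj; apply: nB1; rewrite (bigD1 j)//=; by left.
  move: nB0 nB1; rewrite -!ltNge => Ss Sx.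
  have := excess_risk_arith (pen := pen) (pen' := rho * norm2 (theta_hat w) ^+ 2)
    (Sh := \sum_(i < n) psi beta (alpha * lz (theta_hat w) (Z i w)))
    (Ss := \sum_(i < n) psi beta (alpha * lz thetas (Z i w)))
    (N := n%:R) (a := alpha) (A := alpha `^ beta) (V := V) (s := sigma)
    (t0 := t0) (t1 := t1) (EL := EL) (rj := rr (x j)) (rs := rr thetas)
    (rh := rr (theta_hat w)) N0 a0.
  rewrite mulr_ge0 ?sqr_ge0// => /(_ isT).
  case: (htheta_hat w) => _ /(_ thetas Tstar) argmin /(_ argmin).
  (* As the net point is within [1/n] of the estimator, the Lipschitz bound makes minus the loss at
     the estimator at most [xi j] on each observation; oddness and monotonicity of [psi] carry this
     to the sums. *)
  have Sh_lt : - (\sum_(i < n) psi beta (alpha * lz (theta_hat w) (Z i w))) <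
      n%:R * (alpha * (EL / n%:R - rr (x j)) + alpha `^ beta * V) + t1.
    apply: le_lt_trans Sx; rewrite -sumrN; apply: ler_sum => i _.
    rewrite -psiN; apply: (psi_nondecreasing hbeta).
    rewrite -mulrN ler_pM2l//.
    have := quasi_glm_loss_lipschitz hu hk hg hh (Ys i w) (Xs i w)
      (hbounded _ (xT j)) (hbounded _ (That w)).
    move=> /(le_trans (ler_norm _)).
    have := envelope_ge0 hg_gt0 hh_gt0 (Ys i w) (Xs i w).
    rewrite -norm2N (opprB (x j)) => e0 lip.
    have : envelope g h (Ys i w) (Xs i w) * norm2 (theta_hat w - x j) <=
        n%:R^-1 * envelope g h (Ys i w) (Xs i w).
      by rewrite mulrC ler_wpM2r.
    by rewrite /xi /ez /lz/=; set ni := n%:R^-1; lra.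
  have near : rr (theta_hat w) <= rr (x j) + EL / n%:R.
    by rewrite (le_trans (lipr _ _ (That w) (xT j)))// lerD2l ler_wpM2l.
  move=> /(_ Sh_lt Ss near); rewrite -CE /event/= /bound; lra.
apply: (@le_trans _ _ (P (~` bad))); last first.
  by apply: le_measure => //; rewrite inE//; exact: measurableC.
by rewrite probability_setC// EFinB leeB.
Qed.
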